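(* Let $\mathbf{A}=(K,T,+,;,{}^*,\rightarrow,0,1)$ be a graded Kleene algebra with tests (GKAT) and $n\geq1$. Then $\mathbf{M}(n,\mathbf{A})=(M(n,K),\Delta(n,T),+,;,{}^*,\rightarrow,0_n,I_n)$ is a GKAT; and if $\mathbf{A}$ is an idempotent graded Kleene algebra with tests (I-GKAT), then $\mathbf{M}(n,\mathbf{A})$ is an I-GKAT.
   Context: A GKAT is a tuple $(K,T,+,;,{}^*,\rightarrow,0,1)$ where $K$ is a set, $T\subseteq K$, $0,1\in T$, $+$ and $;$ are binary operations on $K$ under which $T$ is closed, ${}^*$ is unary on $K$, and $\rightarrow$ is a binary operation on $T$ with values in $T$, such that for all $p,q,r\in K$ and $a,b,c\in T$: $p+(q+r)=(p+q)+r$; $p+q=q+p$; $p;(q;r)=(p;q);r$; $p;1=1;p=p$; $p;(q+r)=p;q+p;r$; $(p+q);r=p;r+q;r$; $p;0=0;p=0$; $1+p;p^*=p^*$; $q+p;r\leq r\Rightarrow p^*;q\leq r$; $q+r;p\leq r\Rightarrow q;p^*\leq r$; $a;b\leq c\Leftrightarrow b\leq a\rightarrow c$; $a\leq 1$; $a;b=b;a$, where $p\leq q$ means $p+q=q$. An I-GKAT is a GKAT additionally satisfying $a;a=a$ for all $a\in T$. $M(n,K)$ is the set of $n\times n$ matrices with entries in $K$; $+$ is entrywise addition, $;$ is matrix multiplication $(A;B)_{ij}=\sum_k A_{ik};B_{kj}$ (using $+$ and $;$ of $\mathbf{A}$), $0_n$ the zero matrix, $I_n$ the identity matrix (1 on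 diagonal, 0 elsewhere). ${}^*$ on matrices is the standard Kleene-algebra matrix star: for $n=1$, $[a]^*=[a^*]$; for $n>1$, write $E=\begin{bmatrix}P&Q\\R&S\end{bmatrix}$ with $P$, $S$ square blocks, let $F=P+Q;S^*;R$, and set $E^*=\begin{bmatrix}F^*&F^*;Q;S^*\\S^*;R;F^*&S^*+S^*;R;F^*;Q;S^*\end{bmatrix}$. $\Delta(n,T)$ is the set of diagonal $n\times n$ matrices with diagonal entries in $T$, and for $A,B\in\Delta(n,T)$, $A\rightarrow B$ is the diagonal matrix with $(A\rightarrow B)_{ii}=A_{ii}\rightarrow B_{ii}$ and all off-diagonal entries $0$. *)

(* Defs.v *)
From mathcomp Require Import all_boot all_order all_algebra.

Set Implicit Arguments.
Unset Strict Implicit.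
Unset Printing Implicit Defensive.

(* The operation a → b is only meaningful on tests; as usual it is represented
   by a total function whose values outside [test] are unconstrained. *)
Record gkat_sig : Type := GkatSig {
  carrier :> Type;
  test : carrier -> Prop;
  add : carrier -> carrier -> carrier;
  mul : carrier -> carrier -> carrier;
  star : carrier -> carrier;
  imp : carrier -> carrier -> carrier;
  zero : carrier;
  one : carrier
}.

Arguments test {g} _.
Arguments add {g} _ _.
Arguments mul {g} _ _.
Arguments star {g} _.
Arguments imp {g} _ _.
Arguments zero {g}.
Arguments one {g}.

Definition le (A : gkat_sig) (p q : A) : Prop := add p q = q.

(* Idempotency of [add] and neutrality of [zero] are not listed: they follow
   from [test_le1] at 1 and 0, with distributivity and the unit and zero laws. *)
Record is_gkat (A : gkat_sig) : Prop := IsGkat {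
  test0 : @test A zero;
  test1 : @test A one;
  test_add : forall a b : A, test a -> test b -> test (add a b);
  test_mul : forall a b : A, test a -> test b -> test (mul a b);
  test_imp : forall a b : A, test a -> test b -> test (imp a b);
  addA : forall p q r : A, add p (add q r) = add (add p q) r;
  addC : forall p q : A, add p q = add q p;
  mulA : forall p q r : A, mul p (mul q r) = mul (mul p q) r;
  mulp1 : forall p : A, mul p one = p;
  mul1p : forall p : A, mul one p = p;
  mulDr : forall p q r : A, mul p (add q r) = add (mul p q) (mul p r);
  mulDl : forall p q r : A, mul (add p q) r = add (mul p r) (mul q r);
  mulp0 : forall p : A, mul p zero = zero;
  mul0p : forall p : A, mul zero p = zero;
  star_unfold : forall p : A, add one (mul p (star p)) = star p;
  star_indl : forall p q r : A,
    le (add q (mul p r)) r -> le (mul (star p) q) r;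
  star_indr : forall p q r : A,
    le (add q (mul r p)) r -> le (mul q (star p)) r;
  test_residuation : forall a b c : A, test a -> test b -> test c ->
    (le (mul a b) c <-> le b (imp a c));
  test_le1 : forall a : A, test a -> le a one;
  test_mulC : forall a b : A, test a -> test b -> mul a b = mul b a
}.

Definition is_igkat (A : gkat_sig) : Prop :=
  is_gkat A /\ forall a : A, test a -> mul a a = a.

(* The matrix operations of the library require a (semi)ring structure on the
   entries; only the matrix type and its block operations apply to a bare type. *)
Definition mxadd (A : gkat_sig) (m n : nat) (E F : 'M[A]_(m, n)) :
    'M[A]_(m, n) :=
  \matrix_(i, j) add (E i j) (F i j).

Definition mxmul (A : gkat_sig) (m n p : nat) (E : 'M[A]_(m, n))
    (F : 'M[A]_(n, p)) : 'M[A]_(m, p) :=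
  \matrix_(i, j) \big[add/zero]_(k < n) mul (E i k) (F k j).

Definition mxzero (A : gkat_sig) (n : nat) : 'M[A]_n := const_mx zero.

Definition mxone (A : gkat_sig) (n : nat) : 'M[A]_n :=
  \matrix_(i, j) if i == j then one else zero.

Definition mximp (A : gkat_sig) (n : nat) (E F : 'M[A]_n) : 'M[A]_n :=
  \matrix_(i, j) if i == j then imp (E i i) (F i i) else zero.

Definition mxtest (A : gkat_sig) (n : nat) (E : 'M[A]_n) : Prop :=
  (forall i, test (E i i)) /\ (forall i j, i != j -> E i j = zero).

(* The matrix star is defined by repeatedly splitting a square matrix into
   blocks with square diagonal blocks, in an arbitrary way. A [splitting n]
   records all the choices made for size n: [Split s1 s2] cuts off blocks of
   sizes n1 and n2 (both positive), whose stars are computed using s1 and s2. *)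
Inductive splitting : nat -> Type :=
  | Single : splitting 1
  | Split (n1 n2 : nat) :
      splitting n1 -> splitting n2 -> splitting (n1 + n2).

(* Every size n >= 1 has a splitting. *)
Fixpoint split1 (n : nat) : splitting n.+1 :=
  if n is n'.+1 then Split Single (split1 n') else Single.

Fixpoint mxstar (A : gkat_sig) (n : nat) (s : splitting n) :
    'M[A]_n -> 'M[A]_n :=
  match s in splitting n return 'M[A]_n -> 'M[A]_n with
  | Single => fun E => const_mx (star (E ord0 ord0))
  | Split n1 n2 s1 s2 => fun E : 'M[A]_(n1 + n2) =>
      let P := ulsubmx E in let Q := ursubmx E in
      let R := dlsubmx E in let S := drsubmx E in
      let S' := mxstar s2 S in
      let F' := mxstar s1 (mxadd P (mxmul (mxmul Q S') R)) in
      block_mx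
        F'                      (mxmul (mxmul F' Q) S')
        (mxmul (mxmul S' R) F')
        (mxadd S' (mxmul (mxmul (mxmul (mxmul S' R) F') Q) S'))
  end.

Definition mxgkat (A : gkat_sig) (n : nat) (s : splitting n) : gkat_sig :=
  {| carrier := 'M[A]_n;
     test := @mxtest A n;
     add := @mxadd A n n;
     mul := @mxmul A n n n;
     star := @mxstar A n s;
     imp := @mximp A n;
     zero := mxzero A n;
     one := mxone A n |}.

(* Main.v *)
(* Only the star laws are not entrywise. Writing E = [P Q; R S], an inequality
   E (X; Y) + (U; V) <= (X; Y) gives S* (R X + V) <= Y by induction for S;
   substituting this bound for Y in the first block row gives
   (P + Q S* R) X + U + Q S* V <= X, to which induction for F = P + Q S* R
   applies. *)

From HB Require Import structures.
From mathcomp Require Import all_boot all_order all_algebra.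
Require Import Defs.

Set Implicit Arguments.
Unset Strict Implicit.
Unset Printing Implicit Defensive.

Section GkatMatrix.

(** * The semiring of entries *)

Variables (A : gkat_sig) (hA : is_gkat A).

(** Right multiplication by p carries 0 + 1 = 1, which is [test_le1] at the test 0, to 0 + p = p. *)
Lemma add0p : left_id (@zero A) add.
Proof.
move=> p; have h : add zero one = one := test_le1 hA (test0 hA).
by rewrite -{1}[p](mul1p hA) -{1}(mul0p hA p) -(mulDl hA) h (mul1p hA).
Qed.

Lemma addpp : idempotent_op (@add A).
Proof.
move=> p; have h : add one one = one := test_le1 hA (test1 hA).
by rewrite -{1 2}[p](mul1p hA) -(mulDl hA) h (mul1p hA).
Qed.

(** With this and the next two instances, the generic lemmas on iterated sums, such as [big_distrr]
    and [exchange_big], apply to the entries of a product. *)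
HB.instance Definition _ :=
  Monoid.isComLaw.Build A zero add (addA hA) (addC hA) add0p.

HB.instance Definition _ :=
  Monoid.isMulLaw.Build A zero mul (mul0p hA) (mulp0 hA).

HB.instance Definition _ :=
  Monoid.isAddLaw.Build A mul add (mulDl hA) (mulDr hA).

(** * Sums and products of rectangular matrices *)

Notation mx0 := (const_mx (@zero A)).

Lemma mxaddA m n : associative (@mxadd A m n).
Proof. by move=> E F G; apply/matrixP=> i j; rewrite !mxE (addA hA). Qed.

Lemma mxaddC m n : commutative (@mxadd A m n).
Proof. by move=> E F; apply/matrixP=> i j; rewrite !mxE (addC hA). Qed.

Lemma mxadd0 m n : left_id mx0 (@mxadd A m n).
Proof. by move=> E; apply/matrixP=> i j; rewrite !mxE add0p. Qed.

Lemma mxaddxx m n : idempotent_op (@mxadd A m n).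
Proof. by move=> E; apply/matrixP=> i j; rewrite !mxE addpp. Qed.

HB.instance Definition _ m n := Monoid.isComLaw.Build 'M[A]_(m, n) mx0
  (@mxadd A m n) (@mxaddA m n) (@mxaddC m n) (@mxadd0 m n).

Lemma mxmulA m n p q (E : 'M[A]_(m, n)) (F : 'M[A]_(n, p)) (G : 'M[A]_(p, q)) :
  mxmul E (mxmul F G) = mxmul (mxmul E F) G.
Proof.
apply/matrixP=> i j; rewrite !mxE.
under eq_bigr => k _ do rewrite mxE big_distrr /=.
rewrite exchange_big /=; apply: eq_bigr => l _.
by rewrite mxE big_distrl /=; apply: eq_bigr => k _; rewrite (mulA hA).
Qed.

Lemma mxmulDl m n p (E F : 'M[A]_(m, n)) (G : 'M[A]_(n, p)) :
  mxmul (mxadd E F) G = mxadd (mxmul E G) (mxmul F G).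
Proof.
apply/matrixP=> i j; rewrite !mxE -big_split /=.
by apply: eq_bigr => k _; rewrite mxE (mulDl hA).
Qed.

Lemma mxmulDr m n p (E : 'M[A]_(m, n)) (F G : 'M[A]_(n, p)) :
  mxmul E (mxadd F G) = mxadd (mxmul E F) (mxmul E G).
Proof.
apply/matrixP=> i j; rewrite !mxE -big_split /=.
by apply: eq_bigr => k _; rewrite mxE (mulDr hA).
Qed.

Lemma mxmul0 m n p (E : 'M[A]_(m, n)) : mxmul E mx0 = mx0 :> 'M_(m, p).
Proof.
by apply/matrixP=> i j; rewrite !mxE big1 // => k _; rewrite mxE (mulp0 hA).
Qed.

Lemma mx0mul m n p (E : 'M[A]_(n, p)) : mxmul mx0 E = mx0 :> 'M_(m, p).
Proof.
by apply/matrixP=> i j; rewrite !mxE big1 // => k _; rewrite mxE (mul0p hA).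
Qed.

Lemma mxmul_diagl m n (E : 'M[A]_m) (F : 'M[A]_(m, n)) i j :
  (forall i j, i != j -> E i j = zero) ->
  mxmul E F i j = mul (E i i) (F i j).
Proof.
move=> dE; rewrite mxE (bigD1 i) //= big1 ?Monoid.mulm1 // => k ki.
by rewrite dE 1?eq_sym // (mul0p hA).
Qed.

Lemma mxone_diag n i j : i != j -> mxone A n i j = zero.
Proof. by rewrite mxE => /negbTE ->. Qed.

Lemma mx1mul m n (E : 'M[A]_(m, n)) : mxmul (mxone A m) E = E.
Proof.
apply/matrixP=> i j; rewrite mxmul_diagl; last exact: mxone_diag.
by rewrite mxE eqxx (mul1p hA).
Qed.

Lemma mxmul1 m n (E : 'M[A]_(m, n)) : mxmul E (mxone A n) = E.
Proof.
apply/matrixP=> i j; rewrite mxE (bigD1 j) //= big1 => [|k kj].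
  by rewrite Monoid.mulm1 mxE eqxx (mulp1 hA).
by rewrite mxone_diag // (mulp0 hA).
Qed.

(** * The order on matrices *)

Definition mxle m n (E F : 'M[A]_(m, n)) : Prop := mxadd E F = F.

Lemma mxle_trans m n (F E G : 'M[A]_(m, n)) : mxle E F -> mxle F G -> mxle E G.
Proof. by rewrite /mxle => EF FG; rewrite -FG mxaddA EF. Qed.

Lemma mxle_addr m n (E F : 'M[A]_(m, n)) : mxle E (mxadd E F).
Proof. by rewrite /mxle mxaddA mxaddxx. Qed.

Lemma mxle_addl m n (E F : 'M[A]_(m, n)) : mxle E (mxadd F E).
Proof. by rewrite mxaddC; apply: mxle_addr. Qed.

(** By idempotency of [mxadd], sums are least upper bounds; the star inequalities below are split
    into and rebuilt from single summands this way. *)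
Lemma mxle_lub m n (E F G : 'M[A]_(m, n)) :
  mxle (mxadd E F) G <-> mxle E G /\ mxle F G.
Proof.
split=> [EFG|[EG FG]]; last by rewrite /mxle -mxaddA FG.
by split; apply: mxle_trans EFG; [apply: mxle_addr|apply: mxle_addl].
Qed.

Lemma mxle_mulr m n p (E : 'M[A]_(m, n)) (F G : 'M[A]_(n, p)) :
  mxle F G -> mxle (mxmul E F) (mxmul E G).
Proof. by rewrite /mxle -mxmulDr => ->. Qed.

Lemma mxle_mull m n p (E F : 'M[A]_(m, n)) (G : 'M[A]_(n, p)) :
  mxle E F -> mxle (mxmul E G) (mxmul F G).
Proof. by rewrite /mxle -mxmulDl => ->. Qed.

(** * Block decompositions *)

Lemma mxadd_row m n1 n2 (E G : 'M[A]_(m, n1)) (F H : 'M[A]_(m, n2)) :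
  mxadd (row_mx E F) (row_mx G H) = row_mx (mxadd E G) (mxadd F H).
Proof.
by apply/matrixP=> i j; rewrite !mxE; case: split => k; rewrite !mxE.
Qed.

Lemma mxadd_col m1 m2 n (E G : 'M[A]_(m1, n)) (F H : 'M[A]_(m2, n)) :
  mxadd (col_mx E F) (col_mx G H) = col_mx (mxadd E G) (mxadd F H).
Proof.
by apply/matrixP=> i j; rewrite !mxE; case: split => k; rewrite !mxE.
Qed.

Lemma mxle_row m n1 n2 (E G : 'M[A]_(m, n1)) (F H : 'M[A]_(m, n2)) :
  mxle (row_mx E F) (row_mx G H) <-> mxle E G /\ mxle F H.
Proof. by rewrite /mxle mxadd_row; split=> [/eq_row_mx|[-> ->]]. Qed.

Lemma mxle_col m1 m2 n (E G : 'M[A]_(m1, n)) (F H : 'M[A]_(m2, n)) :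
  mxle (col_mx E F) (col_mx G H) <-> mxle E G /\ mxle F H.
Proof. by rewrite /mxle mxadd_col; split=> [/eq_col_mx|[-> ->]]. Qed.

Lemma mxmul_row_col m n1 n2 p (E : 'M[A]_(m, n1)) (F : 'M[A]_(m, n2))
    (G : 'M[A]_(n1, p)) (H : 'M[A]_(n2, p)) :
  mxmul (row_mx E F) (col_mx G H) = mxadd (mxmul E G) (mxmul F H).
Proof.
apply/matrixP=> i j; rewrite !mxE big_split_ord /=.
congr add; apply: eq_bigr => k _.
  by rewrite row_mxEl col_mxEu.
by rewrite row_mxEr col_mxEd.
Qed.

Lemma mxmul_col m1 m2 n p (E : 'M[A]_(m1, n)) (F : 'M[A]_(m2, n))
    (G : 'M[A]_(n, p)) :
  mxmul (col_mx E F) G = col_mx (mxmul E G) (mxmul F G).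
Proof.
apply/matrixP=> i j; rewrite !mxE.
case: (split_ordP i) => k ->; rewrite mxE; apply: eq_bigr => l _.
  by rewrite col_mxEu.
by rewrite col_mxEd.
Qed.

Lemma mxmul_row m n p1 p2 (E : 'M[A]_(m, n)) (F : 'M[A]_(n, p1))
    (G : 'M[A]_(n, p2)) :
  mxmul E (row_mx F G) = row_mx (mxmul E F) (mxmul E G).
Proof.
apply/matrixP=> i j; rewrite !mxE.
case: (split_ordP j) => k ->; rewrite mxE; apply: eq_bigr => l _.
  by rewrite row_mxEl.
by rewrite row_mxEr.
Qed.

Lemma mxone_block m n :
  mxone A (m + n) = block_mx (mxone A m) mx0 mx0 (mxone A n).
Proof.
apply/matrixP=> i j; case: (split_ordP i) => k ->; case: (split_ordP j) => l ->.
- by rewrite block_mxEul !mxE (inj_eq (@lshift_inj _ _)).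
- by rewrite block_mxEur !mxE eq_lrshift.
- by rewrite block_mxEdl !mxE eq_rlshift.
- by rewrite block_mxEdr !mxE (inj_eq (@rshift_inj _ _)).
Qed.

(** * The star laws for matrices *)

(* Induction is required on rectangular matrices, so that it can be applied to
   the off-diagonal blocks. *)
Record is_star n (E E' : 'M[A]_n) : Prop := IsStar {
  mxstar_unfold : mxadd (mxone A n) (mxmul E E') = E';
  mxstar_indl : forall m (Q R : 'M[A]_(n, m)),
    mxle (mxadd Q (mxmul E R)) R -> mxle (mxmul E' Q) R;
  mxstar_indr : forall m (Q R : 'M[A]_(m, n)),
    mxle (mxadd Q (mxmul R E)) R -> mxle (mxmul Q E') R
}.

(** For left induction [Q] and [R] are single rows, for right induction single columns, so the
    scalar law applies to one entry at a time. *)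
Lemma is_star1 (E : 'M[A]_1) : is_star E (const_mx (star (E ord0 ord0))).
Proof.
split=> [|m Q R h|m Q R h].
- apply/matrixP=> i j; rewrite !mxE big_ord1 mxE !ord1 eqxx.
  exact: star_unfold.
- apply/matrixP=> i j; rewrite !mxE big_ord1 mxE !ord1; apply: star_indl => //.
  by move/matrixP/(_ ord0 j): h; rewrite !mxE big_ord1.
- apply/matrixP=> i j; rewrite !mxE big_ord1 mxE !ord1; apply: star_indr => //.
  by move/matrixP/(_ i ord0): h; rewrite !mxE big_ord1.
Qed.

(** * The star laws for a two-by-two block matrix *)

Section Block.

Variables (n1 n2 : nat) (P : 'M[A]_n1) (Q : 'M[A]_(n1, n2)).
Variables (R : 'M[A]_(n2, n1)) (S S' : 'M[A]_n2) (F' : 'M[A]_n1).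
(** [S'] and [F'] may be any matrices obeying the star laws for [S] and [F], which keeps the block
    step independent of how the blocks are split further. *)
Let F := mxadd P (mxmul (mxmul Q S') R).
Hypotheses (starS : is_star S S') (starF : is_star F F').

Let E := block_mx P Q R S.
Let E' := block_mx
  F'                      (mxmul (mxmul F' Q) S')
  (mxmul (mxmul S' R) F')
  (mxadd S' (mxmul (mxmul (mxmul (mxmul S' R) F') Q) S')).

Lemma block_star_unfold : mxadd (mxone A (n1 + n2)) (mxmul E E') = E'.
Proof.
have eF := mxstar_unfold starF; have eS := mxstar_unfold starS.
(* This is 1 + S S' = S' multiplied by G; it settles the bottom row, as [eF] does the top row. *)
have eSM p (G : 'M[A]_(n2, p)) :
    mxadd G (mxmul S (mxmul S' G)) = mxmul S' G.
  by rewrite -[in RHS]eS mxmulDl mx1mul mxmulA.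
rewrite mxone_block /E /E' /block_mx mxmul_col !mxmul_row_col !mxmul_row.
rewrite !mxadd_row mxadd_col !mxadd_row !mxadd0.
congr (col_mx (row_mx _ _) (row_mx _ _)).
- by rewrite !mxmulA -mxmulDl.
- rewrite -[in RHS]eF !mxmulDl mx1mul !mxmulDr !mxmulA.
  by rewrite mxaddA [mxadd _ (mxmul Q S')]mxaddC -mxaddA.
- by rewrite -!mxmulA eSM.
(* The sum 1 + (R F' Q S' + (S S' + S S' R F' Q S')) is regrouped as (1 + S S') + (R F' Q S' + S S'
   R F' Q S'). *)
- rewrite mxmulDr -!mxmulA (AC (1*(1*2)) ((1*3)*(2*4))) /=.
  by rewrite eS eSM.
Qed.

Lemma block_star_indl m (U X : 'M[A]_(n1 + n2, m)) :
  mxle (mxadd U (mxmul E X)) X -> mxle (mxmul E' U) X.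
Proof.
rewrite -(vsubmxK U) -(vsubmxK X).
(* From here U, V and X, Y are the top and bottom blocks of the two matrices. *)
move: (usubmx U) (dsubmx U) (usubmx X) (dsubmx X) => {}U V {}X Y.
rewrite /E /E' /block_mx !mxmul_col !mxmul_row_col mxadd_col.
case/mxle_col=> /mxle_lub[UX /mxle_lub[PX QY]] hY.
have SY : mxle (mxmul S' (mxadd V (mxmul R X))) Y.
  by apply: (mxstar_indl starS); rewrite -mxaddA.
have FX : mxle (mxmul F' (mxadd U (mxmul (mxmul Q S') V))) X.
  apply: (mxstar_indl starF); rewrite mxmulDl.
  have := mxle_trans (mxle_mulr Q SY) QY.
  rewrite !mxmulDr !mxmulA => /mxle_lub[QV QX].
  by do ![apply/mxle_lub; split].
apply/mxle_col; split; first by rewrite mxmulDr !mxmulA in FX.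
(* The bottom block is bounded by S' (V + R X), which is below Y: multiplying [FX] by S' R puts the
   two terms containing F' below S' R X, and S' V is a summand already. *)
apply: mxle_trans SY; have := mxle_mulr S' (mxle_mulr R FX).
rewrite !mxmulDr !mxmulDl !mxmulA => /mxle_lub[hU hV].
do ![apply/mxle_lub; split].
- exact: mxle_trans hU (mxle_addl _ _).
- exact: mxle_addr.
- exact: mxle_trans hV (mxle_addl _ _).
Qed.

(** The mirror image of [block_star_indl]: the second block column gives (V + X Q) S' <= Y, and
    substituting this into U + X P + Y R <= X gives U + V S' R + X F <= X. *)
Lemma block_star_indr m (U X : 'M[A]_(m, n1 + n2)) :
  mxle (mxadd U (mxmul X E)) X -> mxle (mxmul U E') X.
Proof.
rewrite -(hsubmxK U) -(hsubmxK X).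
move: (lsubmx U) (rsubmx U) (lsubmx X) (rsubmx X) => {}U V {}X Y.
rewrite /E /E' /block_mx !mxmul_row_col !mxmul_row !mxadd_row.
case/mxle_row=> /mxle_lub[UX /mxle_lub[XP YR]] hY.
have SY : mxle (mxmul (mxadd V (mxmul X Q)) S') Y.
  by apply: (mxstar_indr starS); rewrite -mxaddA.
have FX : mxle (mxmul (mxadd U (mxmul V (mxmul S' R))) F') X.
  apply: (mxstar_indr starF); rewrite mxmulDr.
  have := mxle_trans (mxle_mull R SY) YR.
  rewrite !mxmulDl -!mxmulA => /mxle_lub[VR XR].
  by do ![apply/mxle_lub; split].
apply/mxle_row; split; first by rewrite mxmulDl -!mxmulA in FX *.
apply: mxle_trans SY; have := mxle_mull (mxmul Q S') FX.
rewrite !mxmulDl mxmulDr -!mxmulA => /mxle_lub[hU hV].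
do ![apply/mxle_lub; split].
- exact: mxle_trans hU (mxle_addl _ _).
- exact: mxle_addr.
- exact: mxle_trans hV (mxle_addl _ _).
Qed.

Lemma block_is_star : is_star E E'.
Proof.
split; [exact: block_star_unfold|exact: block_star_indl|].
exact: block_star_indr.
Qed.

End Block.

Lemma mxstar_is_star n (s : splitting n) (E : 'M[A]_n) :
  is_star E (mxstar s E).
Proof.
elim: s E => [|n1 n2 s1 IH1 s2 IH2] E; first exact: is_star1.
(* Only the first argument is put in block form; the star of E computes to the block formula in the
   submatrices of E by itself. *)
by rewrite -[E in is_star E _]submxK; apply: block_is_star.
Qed.

(** * Diagonal matrices of tests and the GKAT laws *)

Lemma mxmul_test n (E F : 'M[A]_n) : mxtest E -> mxtest F ->
  mxmul E F =
    (\matrix_(i, j) if i == j then mul (E i i) (F i i) else zero)%R.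
Proof.
move=> [_ dE] [_ dF]; apply/matrixP=> i j; rewrite mxmul_diagl // mxE.
by case: eqVneq => [->|/dF ->]; rewrite ?(mulp0 hA).
Qed.

(** Off the diagonal E is zero, hence below every entry of F, so only the diagonal comparisons
    remain. *)
Lemma mxle_test n (E F : 'M[A]_n) : mxtest E ->
  mxle E F <-> forall i, le (E i i) (F i i).
Proof.
move=> [_ dE]; rewrite /mxle /le; split=> [/matrixP EF i|EF].
  by have:= EF i i; rewrite mxE.
apply/matrixP=> i j; rewrite mxE.
by case: (eqVneq i j) => [->|/dE ->]; rewrite ?add0p.
Qed.

Lemma mxgkat_is_gkat n (s : splitting n) : is_gkat (mxgkat A s).
Proof.
have mxtest_mul (E F : 'M[A]_n) : mxtest E -> mxtest F -> mxtest (mxmul E F).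
  move=> tE tF; rewrite mxmul_test //; split=> [i|i j /negbTE ij].
    by rewrite mxE eqxx; apply: test_mul => //; [case: tE|case: tF].
  by rewrite mxE ij.
split=> /=.
- by split=> [i|i j _]; rewrite mxE //; apply: test0.
- split=> [i|i j]; last exact: mxone_diag.
  by rewrite mxE eqxx; apply: test1.
- move=> E F [tE dE] [tF dF]; split=> [i|i j ij]; rewrite mxE.
    exact: test_add.
  by rewrite dE // dF // add0p.
- exact: mxtest_mul.
- move=> E F [tE _] [tF _]; split=> [i|i j /negbTE ij]; rewrite mxE ?ij //.
  by rewrite eqxx; apply: test_imp.
- exact: mxaddA.
- exact: mxaddC.
- exact: mxmulA.
- exact: mxmul1.
- exact: mx1mul.
- exact: mxmulDr.
- exact: mxmulDl.
- exact: mxmul0.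
- exact: mx0mul.
- by move=> E; exact: mxstar_unfold (mxstar_is_star s E).
- by move=> E Q R; exact: mxstar_indl (mxstar_is_star s E) _ Q R.
- by move=> E Q R; exact: mxstar_indr (mxstar_is_star s E) _ Q R.
- move=> E F G tE tF tG.
  (* On tests both the product and the implication act separately on each diagonal entry, so
     residuation reduces to that of the entries. *)
  have resid i : le (mxmul E F i i) (G i i) <-> le (F i i) (mximp E G i i).
    rewrite mxmul_test // !mxE eqxx; case: tE tF tG => [tE _] [tF _] [tG _].
    exact: test_residuation.
  split=> [/(mxle_test _ (mxtest_mul _ _ tE tF)) EFG|/(mxle_test _ tF) FEG].
    by apply/(mxle_test _ tF) => i; apply/resid.
  by apply/(mxle_test _ (mxtest_mul _ _ tE tF)) => i; apply/resid.
- move=> E tE; apply/(mxle_test _ tE) => i; rewrite mxE eqxx.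
  by apply: test_le1 => //; case: tE.
- move=> E F tE tF; rewrite !mxmul_test //; apply/matrixP=> i j; rewrite !mxE.
  by case: eqP => // _; apply: test_mulC => //; [case: tE|case: tF].
Qed.

End GkatMatrix.

Theorem theorem6 (A : gkat_sig) (hA : is_gkat A) (n : nat) (hn : 1 <= n)
    (s : splitting n) :
  is_gkat (mxgkat A s) /\ (is_igkat A -> is_igkat (mxgkat A s)).
Proof.
split=> [|[_ mulxx]]; first exact: mxgkat_is_gkat.
split=> [|E tE] /=; first exact: mxgkat_is_gkat.
rewrite (mxmul_test hA tE tE); case: tE => tE dE; apply/matrixP=> i j.
by rewrite mxE; case: (eqVneq i j) => [->|/dE ->//]; apply: mulxx.
Qed.
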